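(* The largest element of $(M\setminus L)\cap (b_{\infty}, B_{\infty})$ is $$c = \frac{77+\sqrt{18229}}{82}+\frac{17633692-\sqrt{151905}}{24923467}=3.29304447990138\dots.$$
   Context: Let $\mathbb{N}^*=\{1,2,3,\dots\}$ and let $[a_0;a_1,a_2,\dots]=a_0+\frac{1}{a_1+\frac{1}{a_2+\cdots}}$ denote continued fractions. For $A=(a_n)_{n\in\mathbb{Z}}\in(\mathbb{N}^* )^{\mathbb{Z}}$ and $i\in\mathbb{Z}$ put $\lambda_i(A)=[a_i;a_{i+1},a_{i+2},\dots]+[0;a_{i-1},a_{i-2},\dots]$, $\ell(A)=\limsup_{i\to\infty}\lambda_i(A)$, $m(A)=\sup_{i\in\mathbb{Z}}\lambda_i(A)$. The Lagrange and Markov spectra are (by Perron's characterization) $L=\{\ell(A)<\infty:A\in(\mathbb{N}^* )^{\mathbb{Z}}\}$ and $M=\{m(A)<\infty:A\in(\mathbb{N}^* )^{\mathbb{Z}}\}$. Notation: in a sequence, a subscript on a digit is its multiplicity (e.g. $2_3$ means $2,2,2$), and a bar over a block means that this block is repeated periodically forever. The endpoints are $$b_{\infty} = [2;\overline{1_2,2_3,1,2}]+[0;\overline{1,2_3,1_2,2}] = 3.2930442439\dots,$$ $$B_{\infty} = [2;1,\overline{1,2_3,1,2,1_2,2,1_2,2}]+[0;1,2_3,1_2,2,1,2_3,1_2,2,1,2_2,\overline{1,2_3,1,2,1_2,2,1_2,2}]= 3.2930444814\dots.$$ *)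

(* Defs.v *)
From Stdlib Require Import Reals ZArith List.
From Coquelicot Require Import Coquelicot.
Import ListNotations.

Open Scope R_scope.

(** [convergent a0 a n] is [[a0; a 0, a 1, ..., a (n-1)]]: the tail [a] holds
    the partial quotients from index 1 on, in positions starting at 0. *)
Fixpoint convergent (a0 : Z) (a : nat -> positive) (n : nat) : R :=
  match n with
  | O => IZR a0
  | S n' => IZR a0 + / convergent (Zpos (a O)) (fun k => a (S k)) n'
  end.

(** [[a0; a 0, a 1, ...]].  The convergents have a finite limit since the
    partial quotients in [a] are positive integers, so [real] is harmless. *)
Definition cfrac (a0 : Z) (a : nat -> positive) : R :=
  real (Lim_seq (convergent a0 a)).

Definition lambda (A : Z -> positive) (i : Z) : R :=
  cfrac (Zpos (A i)) (fun k => A (i + 1 + Z.of_nat k)%Z)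
  + cfrac 0 (fun k => A (i - 1 - Z.of_nat k)%Z).

Definition lagrange_value (A : Z -> positive) : Rbar :=
  LimSup_seq (fun n => lambda A (Z.of_nat n)).

Definition markov_value (A : Z -> positive) : Rbar :=
  Lub_Rbar (fun x => exists i : Z, x = lambda A i).

Definition lagrange_spectrum (x : R) : Prop :=
  exists A : Z -> positive, lagrange_value A = Finite x.

Definition markov_spectrum (x : R) : Prop :=
  exists A : Z -> positive, markov_value A = Finite x.

(** The infinite word [pre] followed by [per] repeated forever ([per] is meant
    to be nonempty; the default [1] of [nth] is then never used). *)
Definition eventually_periodic (pre per : list positive) (n : nat) : positive :=
  if (n <? length pre)%nat then nth n pre 1%positive
  else nth ((n - length pre) mod length per) per 1%positive.

Definition b_inf : R :=
  cfrac 2 (eventually_periodic [] [1; 1; 2; 2; 2; 1; 2]%positive)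
  + cfrac 0 (eventually_periodic [] [1; 2; 2; 2; 1; 1; 2]%positive).

Definition B_inf : R :=
  cfrac 2 (eventually_periodic [1]%positive
             [1; 2; 2; 2; 1; 2; 1; 1; 2; 1; 1; 2]%positive)
  + cfrac 0 (eventually_periodic
               [1; 2; 2; 2; 1; 1; 2; 1; 2; 2; 2; 1; 1; 2; 1; 2; 2]%positive
               [1; 2; 2; 2; 1; 2; 1; 1; 2; 1; 1; 2]%positive).

Definition is_largest (S : R -> Prop) (c : R) : Prop :=
  S c /\ forall x : R, S x -> x <= c.

(* Main.v *)
Require Import Defs.
From Stdlib Require Import Reals ZArith List Lia Lra Bool FunctionalExtensionality.
From Coquelicot Require Import Coquelicot.
Import ListNotations.
Open Scope R_scope.

(** Write Q = 1122212, P = 122212112112, stem = 1222112122 and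
    long_stem = 1222112 stem.  The number c is the value of [lambda] at the
    marked digit of the two-sided word that reads 2, then Q Q Q ... on the
    right and stem P P P ... on the left, while [B_inf] is the value at a digit
    2 followed by 1 P P P ... on the right and by long_stem P P P ... on the
    left.

    Let all values [lambda A j] be below [B_inf] and suppose that
    [lambda A i] is at least almost c.  Only the digits 1 and 2 occur, and the value at
    a position is known up to a small error from finitely many digits around
    it, so a finite search over windows ([search_sound]) shows that, up to
    reversal of the sequence, the digits around position [i] start like one of
    the two words above ([core_of_large_lambda]).

    In both cases the tails are controlled by one extremal principle
    ([tail_max]): after suitable contexts, the largest admissible tail is
    P P P ..., because a tail at least as large must begin with P, which
    recreates such a context.  In the second case this gives
    [lambda A i >= B_inf], which is excluded ([B_core_lambda]).  In the first
    case one block Q on the right forces the next one, seven positions further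
    ([stage_step]), so the right side is exactly Q Q Q ..., and the extremal
    principle on the left side gives [lambda A i <= c] ([stage_lambda]).
    Hence no Markov value lies strictly between c and [B_inf].

    The word defining c has [lambda] below 3.2930444 at every other position,
    so c is a Markov value.  It is not a Lagrange value: along a sequence with
    upper limit c, the first word would appear, possibly reversed, infinitely
    often, and the forced period 7 on one side of an occurrence contradicts the
    shape of the other occurrences ([c_cores_clash]). *)

(** * Convergence of continued fractions *)

Definition drop (n : nat) (a : nat -> positive) : nat -> positive :=
  fun k => a (n + k)%nat.

Lemma IZR_pos_ge1 (p : positive) : 1 <= IZR (Zpos p).
Proof. apply IZR_le. lia. Qed.

Lemma convergent_split (z : Z) (a : nat -> positive) (n : nat) :
  convergent z a n = IZR z + convergent 0 a n.
Proof. destruct n; simpl; lra. Qed.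

Lemma convergent_S (a : nat -> positive) (n : nat) :
  convergent 0 a (S n)
  = / (IZR (Zpos (a O)) + convergent 0 (drop 1 a) n).
Proof. simpl. rewrite convergent_split, Rplus_0_l. reflexivity. Qed.

Lemma inv_digit_bounds (p : positive) (t : R) :
  0 <= t -> 0 <= / (IZR (Zpos p) + t) <= 1.
Proof.
  intros Ht. pose proof (IZR_pos_ge1 p) as Hp. split.
  - apply Rlt_le, Rinv_0_lt_compat. lra.
  - rewrite <- Rinv_1. apply Rinv_le_contravar; lra.
Qed.

Lemma convergent_bounds (n : nat) (a : nat -> positive) :
  0 <= convergent 0 a n <= 1.
Proof.
  revert a; induction n as [|n IH]; intros a.
  - simpl. lra.
  - rewrite convergent_S. apply inv_digit_bounds, IH.
Qed.

Lemma inv_digit_contract (p : positive) (s t : R) :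
  0 <= s -> 0 <= t ->
  Rabs (/ (IZR (Zpos p) + s) - / (IZR (Zpos p) + t)) <= Rabs (s - t).
Proof.
  intros Hs Ht. pose proof (IZR_pos_ge1 p) as Hp.
  replace (/ (IZR (Zpos p) + s) - / (IZR (Zpos p) + t))
    with ((t - s) * (/ (IZR (Zpos p) + s) * / (IZR (Zpos p) + t)))
    by (field; lra).
  destruct (inv_digit_bounds p s Hs), (inv_digit_bounds p t Ht).
  rewrite Rabs_mult, (Rabs_minus_sym t s), (Rabs_pos_eq (_ * _))
    by (apply Rmult_le_pos; lra).
  apply Rle_trans with (Rabs (s - t) * (1 * 1)); [|lra].
  apply Rmult_le_compat_l; [apply Rabs_pos|]. apply Rmult_le_compat; lra.
Qed.

(** One step only contracts weakly (by almost nothing when the digit is [1]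
    and the tails are near [0]); two steps always gain a factor [4]. *)
Lemma inv_two_digits_contract (p q : positive) (s t : R) :
  0 <= s -> 0 <= t ->
  Rabs (/ (IZR (Zpos p) + / (IZR (Zpos q) + s))
        - / (IZR (Zpos p) + / (IZR (Zpos q) + t))) <= Rabs (s - t) / 4.
Proof.
  intros Hs Ht.
  pose proof (IZR_pos_ge1 p) as Hp. pose proof (IZR_pos_ge1 q) as Hq.
  set (x := IZR (Zpos p)) in *. set (y := IZR (Zpos q)) in *.
  assert (H : forall u, 0 <= u -> 2 <= x * (y + u) + 1) by (intros; nra).
  pose proof (H s Hs) as Ds. pose proof (H t Ht) as Dt.
  replace (/ (x + / (y + s)) - / (x + / (y + t)))
    with ((s - t) * (/ (x * (y + s) + 1) * / (x * (y + t) + 1)))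
    by (field; nra).
  assert (K : forall u, 2 <= u -> 0 <= / u <= / 2).
  { intros u Hu. split; [apply Rlt_le, Rinv_0_lt_compat; lra|].
    apply Rinv_le_contravar; lra. }
  destruct (K _ Ds), (K _ Dt).
  rewrite Rabs_mult, (Rabs_pos_eq (_ * _)) by (apply Rmult_le_pos; lra).
  apply Rle_trans with (Rabs (s - t) * (/ 2 * / 2)); [|lra].
  apply Rmult_le_compat_l; [apply Rabs_pos|]. apply Rmult_le_compat; lra.
Qed.

(** Two digits are peeled off at each step, for the factor [4]; the free [p]
    and [q] make this the Cauchy criterion. *)
Lemma convergent_cauchy (k p q : nat) (a : nat -> positive) :
  Rabs (convergent 0 a (2 * k + p) - convergent 0 a (2 * k + q)) <= (/ 4) ^ k.
Proof.
  revert a; induction k as [|k IH]; intros a.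
  - simpl. pose proof (convergent_bounds p a). pose proof (convergent_bounds q a).
    apply Rabs_le. lra.
  - replace (2 * S k + p)%nat with (S (S (2 * k + p))) by lia.
    replace (2 * S k + q)%nat with (S (S (2 * k + q))) by lia.
    rewrite !convergent_S.
    eapply Rle_trans.
    + apply inv_two_digits_contract; apply convergent_bounds.
    + specialize (IH (drop 1 (drop 1 a))). simpl pow. lra.
Qed.

Lemma quarter_pow_small (eps : posreal) : exists k, (/ 4) ^ k < eps.
Proof.
  destruct (pow_lt_1_zero (/ 4) ltac:(rewrite Rabs_pos_eq; lra) eps (cond_pos eps))
    as [k Hk].
  exists k. specialize (Hk k (le_n k)).
  rewrite Rabs_pos_eq in Hk by (apply pow_le; lra). exact Hk.
Qed.

(** The form in which contraction is used: an excess that shrinks fourfold at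
    every period of a word is at most zero. *)
Lemma le_of_quarter_pow (x : R) : (forall k, x <= (/ 4) ^ k) -> x <= 0.
Proof.
  intros H. apply Rnot_lt_le. intros Hx.
  destruct (quarter_pow_small (mkposreal x Hx)) as [k Hk].
  specialize (H k). simpl in Hk. lra.
Qed.

Lemma cfrac_is_lim (z : Z) (a : nat -> positive) :
  is_lim_seq (convergent z a) (cfrac z a).
Proof.
  apply Lim_seq_correct', ex_lim_seq_cauchy_corr.
  intros eps. destruct (quarter_pow_small eps) as [k Hk].
  exists (2 * k)%nat. intros n m Hn Hm.
  rewrite (convergent_split z a n), (convergent_split z a m).
  pose proof (convergent_cauchy k (n - 2 * k) (m - 2 * k) a) as H.
  replace (2 * k + (n - 2 * k))%nat with n in H by lia.
  replace (2 * k + (m - 2 * k))%nat with m in H by lia.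
  match goal with
  | |- Rabs ?x < _ =>
      replace x with (convergent 0 a n - convergent 0 a m) by ring
  end.
  lra.
Qed.

Lemma cfrac_unique (z : Z) (a : nat -> positive) (l : R) :
  is_lim_seq (convergent z a) l -> cfrac z a = l.
Proof. intros H. unfold cfrac. rewrite (is_lim_seq_unique _ _ H). reflexivity. Qed.

Lemma cfrac_split (z : Z) (a : nat -> positive) :
  cfrac z a = IZR z + cfrac 0 a.
Proof.
  apply cfrac_unique.
  apply is_lim_seq_ext with (fun n => IZR z + convergent 0 a n).
  - intros n. symmetry. apply convergent_split.
  - apply is_lim_seq_plus' with (l1 := IZR z); [apply is_lim_seq_const|].
    apply cfrac_is_lim.
Qed.

Lemma cfrac_bounds (a : nat -> positive) : 0 <= cfrac 0 a <= 1.
Proof.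
  pose proof (cfrac_is_lim 0 a) as H. split.
  - refine (is_lim_seq_le _ _ (Finite 0) (Finite _) _ (is_lim_seq_const 0) H).
    intros n. apply convergent_bounds.
  - refine (is_lim_seq_le _ _ (Finite _) (Finite 1) _ H (is_lim_seq_const 1)).
    intros n. apply convergent_bounds.
Qed.

Lemma cfrac_step (a : nat -> positive) :
  cfrac 0 a = / (IZR (Zpos (a O)) + cfrac 0 (drop 1 a)).
Proof.
  apply cfrac_unique. apply is_lim_seq_incr_1.
  apply is_lim_seq_ext
    with (fun n => / (IZR (Zpos (a O)) + convergent 0 (drop 1 a) n)).
  - intros n. symmetry. apply convergent_S.
  - pose proof (IZR_pos_ge1 (a O)). pose proof (cfrac_bounds (drop 1 a)).
    apply (is_lim_seq_inv _ (Finite _)).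
    + apply is_lim_seq_plus' with (l1 := IZR (Zpos (a O)));
        [apply is_lim_seq_const|]. apply cfrac_is_lim.
    + intros E. injection E. lra.
Qed.

(** * Finite words and rational enclosures *)

Fixpoint cf_word (l : list positive) (t : R) : R :=
  match l with
  | [] => t
  | d :: l' => / (IZR (Zpos d) + cf_word l' t)
  end.

Fixpoint starts (l : list positive) (a : nat -> positive) : Prop :=
  match l with
  | [] => True
  | d :: l' => a O = d /\ starts l' (drop 1 a)
  end.

Lemma cfrac_starts (l : list positive) (a : nat -> positive) :
  starts l a -> cfrac 0 a = cf_word l (cfrac 0 (drop (length l) a)).
Proof.
  revert a; induction l as [|d l IH]; intros a H.
  - reflexivity.
  - destruct H as [<- H]. rewrite cfrac_step, (IH _ H). reflexivity.
Qed.

Lemma cf_word_bounds (l : list positive) (t : R) :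
  0 <= t <= 1 -> 0 <= cf_word l t <= 1.
Proof.
  intros Ht. induction l as [|d l IH]; simpl; [exact Ht|].
  apply inv_digit_bounds, IH.
Qed.

(** Every digit contributes one inversion, so the direction of monotonicity
    is the parity of the length. *)
Lemma cf_word_monotone (l : list positive) (s t : R) :
  0 <= s <= 1 -> 0 <= t <= 1 -> s <= t ->
  if Nat.even (length l) then cf_word l s <= cf_word l t
  else cf_word l t <= cf_word l s.
Proof.
  intros Hs Ht Hst. induction l as [|d l IH]; [exact Hst|].
  cbn [length]. rewrite Nat.even_succ, <- Nat.negb_even. cbn [cf_word].
  pose proof (IZR_pos_ge1 d).
  pose proof (cf_word_bounds l s Hs). pose proof (cf_word_bounds l t Ht).
  destruct (Nat.even (length l)); cbn [negb]; apply Rinv_le_contravar; lra.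
Qed.

Lemma cf_word_contract (l : list positive) (s t : R) :
  0 <= s <= 1 -> 0 <= t <= 1 -> (2 <= length l)%nat ->
  Rabs (cf_word l s - cf_word l t) <= Rabs (s - t) / 4.
Proof.
  intros Hs Ht. destruct l as [|p [|q l]]; simpl; try lia. intros _.
  apply Rle_trans with (Rabs (cf_word l s - cf_word l t) / 4).
  - apply inv_two_digits_contract; apply cf_word_bounds; assumption.
  - enough (Rabs (cf_word l s - cf_word l t) <= Rabs (s - t)) by lra.
    induction l as [|d l IH]; simpl; [lra|].
    eapply Rle_trans; [|exact IH].
    apply inv_digit_contract; apply cf_word_bounds; assumption.
Qed.

(** [enclose l = ((p, q), (r, s))] encodes [p/q <= cf_word l t <= r/s] for every
    tail [t] between [0] and [1]. *)
Fixpoint enclose (l : list positive) : (Z * Z) * (Z * Z) :=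
  match l with
  | [] => ((0, 1), (1, 1))%Z
  | d :: l' =>
      let '((p, q), (r, s)) := enclose l' in
      ((s, Zpos d * s + r), (q, Zpos d * q + p))%Z
  end.

Lemma enclose_sound (l : list positive) (t : R) :
  0 <= t <= 1 ->
  let '((p, q), (r, s)) := enclose l in
  (0 <= p)%Z /\ (0 < q)%Z /\ (0 <= r)%Z /\ (0 < s)%Z
  /\ IZR p / IZR q <= cf_word l t <= IZR r / IZR s.
Proof.
  intros Ht. induction l as [|d l IH]; cbn -[Z.mul Z.add].
  - repeat split; try lia; lra.
  - destruct (enclose l) as [[p q] [r s]].
    destruct IH as (Hp & Hq & Hr & Hs & Hl & Hu).
    assert (Hd : (0 < Zpos d)%Z) by lia.
    do 4 (split; [nia|]).
    rewrite !plus_IZR, !mult_IZR.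
    apply IZR_lt in Hq, Hs. apply IZR_le in Hp, Hr.
    pose proof (IZR_pos_ge1 d). pose proof (cf_word_bounds l t Ht).
    split.
    + replace (IZR s / (IZR (Zpos d) * IZR s + IZR r))
        with (/ (IZR (Zpos d) + IZR r / IZR s)) by (field; nra).
      apply Rinv_le_contravar; lra.
    + replace (IZR q / (IZR (Zpos d) * IZR q + IZR p))
        with (/ (IZR (Zpos d) + IZR p / IZR q)) by (field; nra).
      apply Rinv_le_contravar; [|lra].
      assert (0 <= IZR p / IZR q); [|lra].
      apply Rmult_le_pos; [lra|]. apply Rlt_le, Rinv_0_lt_compat; lra.
Qed.

Lemma cfrac_enclosed (l : list positive) (a : nat -> positive) :
  starts l a ->
  let '((p, q), (r, s)) := enclose l in
  (0 < q)%Z /\ (0 < s)%Z /\ IZR p / IZR q <= cfrac 0 a <= IZR r / IZR s.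
Proof.
  intros H. rewrite (cfrac_starts _ _ H).
  pose proof (enclose_sound l _ (cfrac_bounds (drop (length l) a))) as E.
  destruct (enclose l) as [[p q] [r s]]. tauto.
Qed.

Lemma starts_app (l m : list positive) (a : nat -> positive) :
  starts (l ++ m) a <-> starts l a /\ starts m (drop (length l) a).
Proof.
  revert a; induction l as [|d l IH]; intros a; simpl.
  - change (drop 0 a) with a. tauto.
  - rewrite IH. change (drop (length l) (drop 1 a)) with (drop (S (length l)) a).
    tauto.
Qed.

Lemma starts_digit (l : list positive) (a : nat -> positive) (k : nat) :
  starts l a -> (k < length l)%nat -> a k = nth k l 1%positive.
Proof.
  revert a k; induction l as [|d l IH]; intros a k H Hk; [simpl in Hk; lia|].
  destruct H as [H0 H], k as [|k]; [exact H0|].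
  cbn [length] in Hk. cbn [nth]. rewrite <- (IH _ k H) by lia. reflexivity.
Qed.

Fixpoint prefixb (l m : list positive) : bool :=
  match l, m with
  | [], _ => true
  | d :: l', e :: m' => Pos.eqb d e && prefixb l' m'
  | _ :: _, [] => false
  end.

Lemma prefixb_starts (l m : list positive) (a : nat -> positive) :
  prefixb l m = true -> starts m a -> starts l a.
Proof.
  revert m a; induction l as [|d l IH]; intros [|e m] a; simpl; try easy.
  rewrite andb_true_iff, Pos.eqb_eq. intros [-> H] [Ha Hm]. eauto.
Qed.

Lemma starts_of_nth (l : list positive) (a : nat -> positive) :
  (forall k, (k < length l)%nat -> a k = nth k l 1%positive) -> starts l a.
Proof.
  revert a; induction l as [|d l IH]; intros a H; [exact I|]. split.
  - apply (H O). simpl. lia.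
  - apply IH. intros k Hk. apply (H (S k)). simpl. lia.
Qed.

Lemma starts_map_seq (a : nat -> positive) (n : nat) : starts (map a (seq 0 n)) a.
Proof.
  apply starts_of_nth. intros k Hk. rewrite length_map, length_seq in Hk.
  rewrite nth_indep with (d' := a O) by (rewrite length_map, length_seq; lia).
  rewrite map_nth, seq_nth by lia. reflexivity.
Qed.

(** * Bi-infinite sequences and their windows *)

Definition right_of (A : Z -> positive) (i : Z) : nat -> positive :=
  fun k => A (i + 1 + Z.of_nat k)%Z.

Definition left_of (A : Z -> positive) (i : Z) : nat -> positive :=
  fun k => A (i - 1 - Z.of_nat k)%Z.

Lemma lambda_split (A : Z -> positive) (i : Z) :
  lambda A i
  = IZR (Zpos (A i)) + cfrac 0 (right_of A i) + cfrac 0 (left_of A i).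
Proof. unfold lambda. rewrite cfrac_split. reflexivity. Qed.

(** [L] is read away from position [i], so its head is the digit at [i - 1];
    with this convention a move of the centre is a move in a zipper
    ([window_right], [window_left]). *)
Definition window (A : Z -> positive) (i : Z)
    (L : list positive) (c : positive) (R : list positive) : Prop :=
  starts L (left_of A i) /\ A i = c /\ starts R (right_of A i).

Lemma right_of_drop (A : Z -> positive) (i : Z) (n : nat) :
  drop n (right_of A i) = right_of A (i + Z.of_nat n).
Proof.
  apply functional_extensionality. intros k. unfold drop, right_of. f_equal. lia.
Qed.

Lemma left_of_drop (A : Z -> positive) (i : Z) (n : nat) :
  drop n (left_of A i) = left_of A (i - Z.of_nat n).
Proof.
  apply functional_extensionality. intros k. unfold drop, left_of. f_equal. lia.
Qed.

Lemma window_right (A : Z -> positive) (i : Z) L c d R :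
  window A i L c (d :: R) <-> window A (i + 1) (c :: L) d R.
Proof.
  unfold window. cbn [starts].
  rewrite right_of_drop, left_of_drop.
  replace (i + 1 - Z.of_nat 1)%Z with i by lia.
  replace (right_of A i 0) with (A (i + 1)%Z)
    by (unfold right_of; f_equal; lia).
  replace (left_of A (i + 1) 0) with (A i) by (unfold left_of; f_equal; lia).
  simpl. tauto.
Qed.

Lemma window_left (A : Z -> positive) (i : Z) L c d R :
  window A i (d :: L) c R <-> window A (i - 1) L d (c :: R).
Proof.
  rewrite window_right. replace (i - 1 + 1)%Z with i by lia. tauto.
Qed.

Lemma window_advance (A : Z -> positive) (i : Z) L c l d R :
  window A i L c (l ++ d :: R) ->
  window A (i + Z.of_nat (length l) + 1) (rev l ++ c :: L) d R.
Proof.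
  revert i L c; induction l as [|e l IH]; intros i L c H.
  - apply window_right in H. simpl. rewrite Z.add_0_r. exact H.
  - apply (proj1 (window_right _ _ _ _ _ _)), IH in H.
    cbn [rev length]. rewrite <- app_assoc.
    replace (i + Z.of_nat (S (length l)) + 1)%Z
      with (i + 1 + Z.of_nat (length l) + 1)%Z by lia.
    exact H.
Qed.

Definition mirror (A : Z -> positive) : Z -> positive := fun j => A (- j)%Z.

Lemma mirror_left (A : Z -> positive) (i : Z) :
  left_of (mirror A) i = right_of A (- i).
Proof.
  apply functional_extensionality. intros k.
  unfold left_of, right_of, mirror. f_equal. lia.
Qed.

Lemma mirror_right (A : Z -> positive) (i : Z) :
  right_of (mirror A) i = left_of A (- i).
Proof.
  apply functional_extensionality. intros k.
  unfold left_of, right_of, mirror. f_equal. lia.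
Qed.

Lemma lambda_mirror (A : Z -> positive) (i : Z) :
  lambda (mirror A) i = lambda A (- i).
Proof.
  rewrite !lambda_split, mirror_left, mirror_right. unfold mirror. ring.
Qed.

Lemma window_mirror (A : Z -> positive) (i : Z) L c R :
  window (mirror A) i L c R <-> window A (- i) R c L.
Proof.
  unfold window. rewrite mirror_left, mirror_right. unfold mirror. tauto.
Qed.

(** * Exhaustive search over admissible windows *)

(** All numerical thresholds are integers read in units of the tenth decimal,
    which is fine enough to separate [c] from [B_inf] and keeps every
    comparison in [Z]. *)
Definition dec10 (n : Z) : R := IZR n / 10000000000.

(** [above] and [below] only use the digits of the window: they compare the
    least, respectively the greatest, value that [lambda] can take there when
    the unknown tails range over all of the unit interval. *)
Definition above (n : Z) (L : list positive) (c : positive) (R : list positive)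
    : bool :=
  let '((p, q), _) := enclose L in
  let '((p', q'), _) := enclose R in
  (n * (q * q') <? 10000000000 * (Zpos c * (q * q') + p * q' + p' * q))%Z.

Definition below (n : Z) (L : list positive) (c : positive) (R : list positive)
    : bool :=
  let '(_, (r, s)) := enclose L in
  let '(_, (r', s')) := enclose R in
  (10000000000 * (Zpos c * (s * s') + r * s' + r' * s) <? n * (s * s'))%Z.

Lemma above_sum (a b : nat -> positive) (n : Z) L c R :
  starts L a -> starts R b -> above n L c R = true ->
  dec10 n < IZR (Zpos c) + cfrac 0 b + cfrac 0 a.
Proof.
  intros HL HR H.
  pose proof (cfrac_enclosed _ _ HL) as EL. pose proof (cfrac_enclosed _ _ HR) as ER.
  unfold above in H.
  destruct (enclose L) as [[p q] [r s]], (enclose R) as [[p' q'] [r' s']].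
  destruct EL as (Hq & Hs & EL), ER as (Hq' & Hs' & ER).
  apply Z.ltb_lt, IZR_lt in H. apply IZR_lt in Hq, Hq'.
  rewrite !mult_IZR, !plus_IZR, !mult_IZR in H.
  eapply Rlt_le_trans with (IZR (Zpos c) + IZR p' / IZR q' + IZR p / IZR q);
    [|lra].
  unfold dec10.
  apply Rmult_lt_reg_r with (10000000000 * (IZR q * IZR q')); [nra|].
  replace (IZR n / 10000000000 * (10000000000 * (IZR q * IZR q')))
    with (IZR n * (IZR q * IZR q')) by field.
  replace ((IZR (Zpos c) + IZR p' / IZR q' + IZR p / IZR q)
           * (10000000000 * (IZR q * IZR q')))
    with (10000000000 * (IZR (Zpos c) * (IZR q * IZR q')
                         + IZR p * IZR q' + IZR p' * IZR q)) by (field; lra).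
  exact H.
Qed.

Lemma above_sound (A : Z -> positive) (i n : Z) L c R :
  window A i L c R -> above n L c R = true -> dec10 n < lambda A i.
Proof.
  intros (HL & Hc & HR) H. rewrite lambda_split, Hc.
  exact (above_sum _ _ _ _ _ _ HL HR H).
Qed.

Lemma below_sum (a b : nat -> positive) (n : Z) L c R :
  starts L a -> starts R b -> below n L c R = true ->
  IZR (Zpos c) + cfrac 0 b + cfrac 0 a < dec10 n.
Proof.
  intros HL HR H.
  pose proof (cfrac_enclosed _ _ HL) as EL. pose proof (cfrac_enclosed _ _ HR) as ER.
  unfold below in H.
  destruct (enclose L) as [[p q] [r s]], (enclose R) as [[p' q'] [r' s']].
  destruct EL as (Hq & Hs & EL), ER as (Hq' & Hs' & ER).
  apply Z.ltb_lt, IZR_lt in H. apply IZR_lt in Hs, Hs'.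
  rewrite !mult_IZR, !plus_IZR, !mult_IZR in H.
  eapply Rle_lt_trans with (IZR (Zpos c) + IZR r' / IZR s' + IZR r / IZR s);
    [lra|].
  unfold dec10.
  apply Rmult_lt_reg_r with (10000000000 * (IZR s * IZR s')); [nra|].
  replace (IZR n / 10000000000 * (10000000000 * (IZR s * IZR s')))
    with (IZR n * (IZR s * IZR s')) by field.
  replace ((IZR (Zpos c) + IZR r' / IZR s' + IZR r / IZR s)
           * (10000000000 * (IZR s * IZR s')))
    with (10000000000 * (IZR (Zpos c) * (IZR s * IZR s')
                         + IZR r * IZR s' + IZR r' * IZR s)) by (field; lra).
  exact H.
Qed.

Lemma below_sound (A : Z -> positive) (i n : Z) L c R :
  window A i L c R -> below n L c R = true -> lambda A i < dec10 n.
Proof.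
  intros (HL & Hc & HR) H. rewrite lambda_split, Hc.
  exact (below_sum _ _ _ _ _ _ HL HR H).
Qed.

(** Just above [B_inf]. *)
Definition cap : Z := 32930444820.

(** The local constraint is imposed on a range of positions only, because for
    the Lagrange spectrum it is available only far to the right. *)
Definition admissible (A : Z -> positive) (lo hi : Z) : Prop :=
  forall j, (lo <= j <= hi)%Z ->
  (A j = 1%positive \/ A j = 2%positive) /\ lambda A j <= dec10 cap.

Lemma admissible_sub (A : Z -> positive) (lo hi lo' hi' : Z) :
  (lo <= lo')%Z -> (hi' <= hi)%Z -> admissible A lo hi -> admissible A lo' hi'.
Proof. intros Hlo Hhi H j Hj. apply H. lia. Qed.

Lemma admissible_mirror (A : Z -> positive) (lo hi : Z) :
  admissible A lo hi -> admissible (mirror A) (- hi) (- lo).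
Proof.
  intros H j Hj. rewrite lambda_mirror. apply (H (- j)%Z). lia.
Qed.

Definition admissible_everywhere (A : Z -> positive) : Prop :=
  forall lo hi, admissible A lo hi.

Lemma admissible_everywhere_mirror (A : Z -> positive) :
  admissible_everywhere A -> admissible_everywhere (mirror A).
Proof.
  intros HA lo hi. pose proof (admissible_mirror A (- hi) (- lo) (HA _ _)) as M.
  rewrite !Z.opp_involutive in M. exact M.
Qed.

(** A window is impossible as soon as some position in it, not only the
    centre, has a value above [cap]; the zipper walks over all of them. *)
Fixpoint exceeds_right (L : list positive) (c : positive) (R : list positive) : bool :=
  above cap L c R
  || match R with [] => false | d :: R' => exceeds_right (c :: L) d R' end.

Fixpoint exceeds_left (L : list positive) (c : positive) (R : list positive) : bool :=
  above cap L c R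
  || match L with [] => false | d :: L' => exceeds_left L' d (c :: R) end.

Lemma exceeds_right_sound (A : Z -> positive) (lo hi i : Z) R :
  admissible A lo hi -> (lo <= i)%Z -> (i + Z.of_nat (length R) <= hi)%Z ->
  forall L c, window A i L c R -> exceeds_right L c R = true -> False.
Proof.
  intros HA. revert i; induction R as [|d R IH]; intros i Hlo Hhi L c Hw;
    cbn [exceeds_right]; rewrite orb_true_iff; intros [H|H].
  - apply (above_sound _ _ _ _ _ _ Hw) in H.
    destruct (HA i) as [_ Hi]; [simpl in Hhi; lia|]. lra.
  - discriminate.
  - apply (above_sound _ _ _ _ _ _ Hw) in H.
    destruct (HA i) as [_ Hi]; [simpl in Hhi; lia|]. lra.
  - apply window_right in Hw. revert H.
    apply (IH (i + 1)%Z); [lia|cbn [length] in Hhi; lia|exact Hw].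
Qed.

Lemma exceeds_left_sound (A : Z -> positive) (lo hi i : Z) L :
  admissible A lo hi -> (lo <= i - Z.of_nat (length L))%Z -> (i <= hi)%Z ->
  forall c R, window A i L c R -> exceeds_left L c R = true -> False.
Proof.
  intros HA. revert i; induction L as [|d L IH]; intros i Hlo Hhi c R Hw;
    cbn [exceeds_left]; rewrite orb_true_iff; intros [H|H].
  - apply (above_sound _ _ _ _ _ _ Hw) in H.
    destruct (HA i) as [_ Hi]; [simpl in Hlo; lia|]. lra.
  - discriminate.
  - apply (above_sound _ _ _ _ _ _ Hw) in H.
    destruct (HA i) as [_ Hi]; [simpl in Hlo; lia|]. lra.
  - apply window_left in Hw. revert H.
    apply (IH (i - 1)%Z); [cbn [length] in Hlo; lia|lia|exact Hw].
Qed.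

(** Both digits are tried on the shorter side, until a window is impossible or
    [done] recognises it.  Balanced growth is what makes the enclosures at the
    centre shrink; a long given [L] makes the search grow to the right only. *)
Fixpoint search (done : list positive -> list positive -> bool) (fuel : nat)
    (L R : list positive) : bool :=
  (* A conditional, not a disjunction: call-by-value evaluation would explore
     the branches below a settled window. *)
  if done L R || exceeds_right L 2 R || exceeds_left L 2 R then true
  else match fuel with
     | O => false
     | S n =>
         if (length R <=? length L)%nat
         then search done n L (R ++ [1%positive])
              && search done n L (R ++ [2%positive])
         else search done n (L ++ [1%positive]) R
              && search done n (L ++ [2%positive]) R
     end.

Lemma window_extend_right (A : Z -> positive) (i : Z) L c R d :
  window A i L c R -> A (i + Z.of_nat (length R) + 1)%Z = d ->
  window A i L c (R ++ [d]).
Proof.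
  intros (HL & Hc & HR) Hd. repeat split; auto.
  apply starts_app. split; [exact HR|]. split; [|exact I].
  rewrite right_of_drop, <- Hd. unfold right_of. f_equal. lia.
Qed.

Lemma window_extend_left (A : Z -> positive) (i : Z) L c R d :
  window A i L c R -> A (i - Z.of_nat (length L) - 1)%Z = d ->
  window A i (L ++ [d]) c R.
Proof.
  intros (HL & Hc & HR) Hd. repeat split; auto.
  apply starts_app. split; [exact HL|]. split; [|exact I].
  rewrite left_of_drop, <- Hd. unfold left_of. f_equal. lia.
Qed.

(** The radius [M] must cover the longest window that the search can build,
    since the constraint is consulted at all of its positions. *)
Lemma search_sound (A : Z -> positive) (i M : Z) (G : Prop) done :
  admissible A (i - M) (i + M) ->
  (forall L R, done L R = true -> window A i L 2 R -> G) ->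
  forall fuel L R,
  (Z.of_nat (length L + fuel) <= M)%Z -> (Z.of_nat (length R + fuel) <= M)%Z ->
  search done fuel L R = true -> window A i L 2 R -> G.
Proof.
  intros HA HG. induction fuel as [|n IH]; intros L R HL HR HS Hw;
    cbn [search] in HS;
    (destruct (done L R || exceeds_right L 2 R || exceeds_left L 2 R) eqn:E;
     [clear HS; rewrite !orb_true_iff in E; destruct E as [[HS|HS]|HS]|]).
  1, 5: exact (HG _ _ HS Hw).
  1, 4: exfalso; revert HS; apply (exceeds_right_sound A (i - M) (i + M) i); auto; lia.
  1, 3: exfalso; revert HS; apply (exceeds_left_sound A (i - M) (i + M) i); auto; lia.
  - discriminate.
  - destruct (length R <=? length L)%nat; apply andb_true_iff in HS;
      destruct HS as [H1 H2].
    + destruct (HA (i + Z.of_nat (length R) + 1)%Z) as [[Hd|Hd] _]; [lia| |].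
      * apply (IH L (R ++ [1%positive])); auto; try lia.
        -- rewrite length_app. simpl. lia.
        -- apply window_extend_right; auto.
      * apply (IH L (R ++ [2%positive])); auto; try lia.
        -- rewrite length_app. simpl. lia.
        -- apply window_extend_right; auto.
    + destruct (HA (i - Z.of_nat (length L) - 1)%Z) as [[Hd|Hd] _]; [lia| |].
      * apply (IH (L ++ [1%positive]) R); auto; try lia.
        -- rewrite length_app. simpl. lia.
        -- apply window_extend_left; auto.
      * apply (IH (L ++ [2%positive]) R); auto; try lia.
        -- rewrite length_app. simpl. lia.
        -- apply window_extend_left; auto.
Qed.

(** * The two extremal patterns *)

Definition P_word : list positive := [1; 2; 2; 2; 1; 2; 1; 1; 2; 1; 1; 2]%positive.
Definition Q_word : list positive := [1; 1; 2; 2; 2; 1; 2]%positive.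
Definition stem : list positive := [1; 2; 2; 2; 1; 1; 2; 1; 2; 2]%positive.
Definition long_stem : list positive := [1; 2; 2; 2; 1; 1; 2]%positive ++ stem.

(** Three digits of the second period are included so that the enclosure of
    [lambda] on this pattern lies above [ceil_c]. *)
Definition B_right : list positive := 1%positive :: P_word ++ firstn 3 P_word.

(** Four digits of Q on the right suffice to force the rest.  The digit [1]
    after [stem] breaks the period 7 that would continue [stem] by [2]; it is
    what makes two occurrences incompatible. *)
Definition c_core (A : Z -> positive) (i : Z) : Prop :=
  window A i (stem ++ [1%positive]) 2 (firstn 4 Q_word).
Definition B_core (A : Z -> positive) (i : Z) : Prop :=
  window A i long_stem 2 B_right.

Definition B_coreb (L R : list positive) : bool :=
  prefixb long_stem L && prefixb B_right R.
Definition coreb (L R : list positive) : bool :=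
  (prefixb (stem ++ [1%positive]) L && prefixb (firstn 4 Q_word) R) || B_coreb L R.

(** Just below [c]. *)
Definition floor_c : Z := 32930444798.

Lemma window_prefix (A : Z -> positive) (i : Z) L c R L' R' :
  prefixb L' L && prefixb R' R = true -> window A i L c R -> window A i L' c R'.
Proof.
  rewrite andb_true_iff. intros [HL HR] (H1 & H2 & H3).
  repeat split; eauto using prefixb_starts.
Qed.

Definition core_done (L R : list positive) : bool :=
  below floor_c L 2 R || coreb L R || coreb R L.

Lemma core_search : search core_done 36 [] [] = true.
Proof. vm_compute. reflexivity. Qed.

Definition core (A : Z -> positive) (i : Z) : Prop := c_core A i \/ B_core A i.

Lemma coreb_sound (A : Z -> positive) (i : Z) L R :
  coreb L R = true -> window A i L 2 R -> core A i.
Proof.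
  intros H Hw. apply orb_true_iff in H as [H|H].
  - left. eapply window_prefix; eauto.
  - right. eapply window_prefix; eauto.
Qed.

(** The search inspects only windows centred at [2]; a digit [1] at the centre
    would make [lambda A i] at most [3]. *)
Lemma core_of_large_lambda (A : Z -> positive) (i : Z) :
  admissible A (i - 36) (i + 36) -> dec10 floor_c <= lambda A i ->
  core A i \/ core (mirror A) (- i).
Proof.
  intros HA Hi.
  assert (Hc : A i = 2%positive).
  { destruct (HA i) as [[H|H] _]; [lia| |exact H]. exfalso.
    rewrite lambda_split, H in Hi.
    pose proof (cfrac_bounds (right_of A i)). pose proof (cfrac_bounds (left_of A i)).
    unfold dec10, floor_c in Hi. lra. }
  apply (search_sound A i 36 _ core_done HA) with (fuel := 36%nat) (L := []) (R := []).
  - intros L R H Hw. unfold core_done in H. rewrite !orb_true_iff in H.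
    destruct H as [[H|H]|H].
    + exfalso. apply (below_sound _ _ _ _ _ _ Hw) in H. lra.
    + left. eapply coreb_sound; eauto.
    + right. eapply coreb_sound; eauto.
      apply window_mirror. rewrite Z.opp_involutive. exact Hw.
  - simpl. lia.
  - simpl. lia.
  - exact core_search.
  - repeat split; auto.
Qed.

Definition step_done (L R : list positive) : bool :=
  prefixb (Q_word ++ firstn 4 Q_word) R || B_coreb L R.

Lemma step_search : search step_done 36 stem (firstn 4 Q_word) = true.
Proof. vm_compute. reflexivity. Qed.

(** The part of the pattern of [c_core] that reappears seven positions to the
    right: [stem] is a prefix of 1222112 [stem], the left side seen there. *)
Definition stage (A : Z -> positive) (i : Z) : Prop :=
  window A i stem 2 (firstn 4 Q_word).

(** The radius is the fuel [36] plus the ten digits of [stem]. *)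
Lemma stage_step (A : Z -> positive) (i : Z) :
  admissible A (i - 46) (i + 46) -> stage A i ->
  (starts Q_word (right_of A i) /\ stage A (i + 7)) \/ B_core A i.
Proof.
  intros HA Hs.
  apply (search_sound A i 46 _ step_done HA) with
    (fuel := 36%nat) (L := stem) (R := firstn 4 Q_word).
  - intros L R H Hw. apply orb_true_iff in H as [H|H].
    + left.
      assert (W : window A i stem 2 (Q_word ++ firstn 4 Q_word)).
      { destruct Hs as (H1 & H2 & _), Hw as (_ & _ & H3).
        split; [exact H1|split; [exact H2|]]. eapply prefixb_starts; eauto. }
      split.
      * destruct W as (_ & _ & W). apply starts_app in W. apply W.
      * apply (window_advance A i stem 2 (removelast Q_word)) in W.
        replace (i + 7)%Z with (i + Z.of_nat (length (removelast Q_word)) + 1)%Z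
          by (simpl length; lia).
        eapply window_prefix; [|exact W]. reflexivity.
    + right. eapply window_prefix; eauto.
  - simpl. lia.
  - simpl. lia.
  - exact step_search.
  - exact Hs.
Qed.

Lemma stage_forever (A : Z -> positive) (i hi : Z) :
  admissible A (i - 46) hi ->
  (forall j, (i <= j)%Z -> (j + 46 <= hi)%Z -> ~ B_core A j) ->
  stage A i ->
  forall k, (i + 7 * Z.of_nat k + 46 <= hi)%Z ->
  stage A (i + 7 * Z.of_nat k) /\ starts Q_word (right_of A (i + 7 * Z.of_nat k)).
Proof.
  intros HA HB Hs. induction k as [|k IH]; intros Hk.
  - replace (i + 7 * Z.of_nat 0)%Z with i in * by lia. split; [exact Hs|].
    destruct (stage_step A i) as [[H _]|H]; auto.
    + eapply admissible_sub; [| |exact HA]; lia.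
    + exfalso. revert H. apply HB; lia.
  - destruct IH as [H _]; [lia|].
    assert (E : stage A (i + 7 * Z.of_nat (S k))).
    { destruct (stage_step A (i + 7 * Z.of_nat k)) as [[_ E]|E].
      - eapply admissible_sub; [| |exact HA]; lia.
      - exact H.
      - replace (i + 7 * Z.of_nat (S k))%Z with (i + 7 * Z.of_nat k + 7)%Z by lia.
        exact E.
      - exfalso. revert E. apply HB; lia. }
    split; [exact E|].
    destruct (stage_step A (i + 7 * Z.of_nat (S k))) as [[E' _]|E']; auto.
    + eapply admissible_sub; [| |exact HA]; lia.
    + exfalso. revert E'. apply HB; lia.
Qed.

(** * Periodic tails *)

Definition periodic (per : list positive) : nat -> positive :=
  eventually_periodic [] per.

Lemma eventually_periodic_starts (pre per : list positive) :
  starts pre (eventually_periodic pre per).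
Proof.
  apply starts_of_nth. intros k Hk. unfold eventually_periodic.
  apply Nat.ltb_lt in Hk. rewrite Hk. reflexivity.
Qed.

Lemma eventually_periodic_drop (pre per : list positive) :
  drop (length pre) (eventually_periodic pre per) = periodic per.
Proof.
  apply functional_extensionality. intros k.
  unfold drop, periodic, eventually_periodic. simpl.
  destruct (Nat.ltb_spec (length pre + k) (length pre)); [lia|].
  f_equal. f_equal. lia.
Qed.

Lemma periodic_starts (per : list positive) : starts per (periodic per).
Proof.
  apply starts_of_nth. intros k Hk. unfold periodic, eventually_periodic. simpl.
  rewrite Nat.sub_0_r, Nat.mod_small by exact Hk. reflexivity.
Qed.

Lemma periodic_drop (per : list positive) :
  per <> [] -> drop (length per) (periodic per) = periodic per.
Proof.
  intros Hper. apply functional_extensionality. intros k.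
  unfold drop, periodic, eventually_periodic. simpl. f_equal.
  rewrite !Nat.sub_0_r.
  replace (length per + k)%nat with (k + 1 * length per)%nat by lia.
  apply Nat.Div0.mod_add.
Qed.

Lemma cfrac_eventually_periodic (pre per : list positive) :
  cfrac 0 (eventually_periodic pre per) = cf_word pre (cfrac 0 (periodic per)).
Proof.
  rewrite (cfrac_starts pre) by apply eventually_periodic_starts.
  rewrite eventually_periodic_drop. reflexivity.
Qed.

Lemma cfrac_periodic (per : list positive) :
  per <> [] -> cfrac 0 (periodic per) = cf_word per (cfrac 0 (periodic per)).
Proof.
  intros H. rewrite (cfrac_starts per) at 1 by apply periodic_starts.
  rewrite periodic_drop by exact H. reflexivity.
Qed.

Definition P_value : R := cfrac 0 (periodic P_word).
Definition Q_value : R := cfrac 0 (periodic Q_word).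

Lemma B_inf_words : B_inf = 2 + cf_word [1%positive] P_value + cf_word long_stem P_value.
Proof.
  change B_inf with (cfrac 2 (eventually_periodic [1%positive] P_word)
                     + cfrac 0 (eventually_periodic long_stem P_word)).
  rewrite (cfrac_split 2).
  rewrite (cfrac_eventually_periodic [1%positive] P_word).
  rewrite (cfrac_eventually_periodic long_stem P_word). reflexivity.
Qed.

(** Each period contracts the distance to the fixed point of [cf_word w]. *)
Lemma cfrac_forced_periodic (w : list positive) (a : nat -> positive) :
  (2 <= length w)%nat ->
  (forall k, starts w (drop (k * length w) a)) ->
  cfrac 0 a = cfrac 0 (periodic w).
Proof.
  intros Hw H.
  assert (Hne : w <> []) by (intros ->; simpl in Hw; lia).
  set (x := cfrac 0 (periodic w)).
  assert (K : forall n k, Rabs (cfrac 0 (drop (k * length w) a) - x) <= (/ 4) ^ n).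
  { induction n as [|n IH]; intros k.
    - pose proof (cfrac_bounds (drop (k * length w) a)).
      pose proof (cfrac_bounds (periodic w)) as B. fold x in B.
      simpl pow. apply Rabs_le. lra.
    - rewrite (cfrac_starts _ _ (H k)). unfold x.
      rewrite cfrac_periodic by exact Hne. fold x.
      replace (drop (length w) (drop (k * length w) a))
        with (drop (S k * length w) a)
        by (apply functional_extensionality; intros m; unfold drop; f_equal; lia).
      eapply Rle_trans.
      + apply cf_word_contract; [apply cfrac_bounds|apply cfrac_bounds|exact Hw].
      + specialize (IH (S k)). simpl pow. lra. }
  pose proof (le_of_quarter_pow _ (fun n => K n O)) as E.
  change (drop (0 * length w) a) with a in E.
  pose proof (Rabs_pos (cfrac 0 a - x)).
  apply Rminus_diag_uniq. apply Rabs_eq_0. lra.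
Qed.

(** * The largest admissible tail *)

(** The first ten decimals of the continued fraction with period P, rounded
    down. *)
Definition P_floor : Z := 7078055688.

Definition too_small (R : list positive) : bool :=
  let '(_, (r, s)) := enclose R in
  (10000000000 * r <? P_floor * s)%Z.

Lemma too_small_sound (R : list positive) (a : nat -> positive) :
  starts R a -> too_small R = true -> cfrac 0 a < dec10 P_floor.
Proof.
  intros HR H. pose proof (cfrac_enclosed _ _ HR) as E.
  unfold too_small in H. destruct (enclose R) as [[p q] [r s]].
  destruct E as (_ & Hs & _ & E).
  apply Z.ltb_lt, IZR_lt in H. apply IZR_lt in Hs. rewrite !mult_IZR in H.
  eapply Rle_lt_trans; [exact E|]. unfold dec10.
  apply Rmult_lt_reg_r with (10000000000 * IZR s); [lra|].
  replace (IZR r / IZR s * (10000000000 * IZR s))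
    with (10000000000 * IZR r) by (field; lra).
  replace (IZR P_floor / 10000000000 * (10000000000 * IZR s))
    with (IZR P_floor * IZR s) by field.
  exact H.
Qed.

Lemma P_floor_lt : dec10 P_floor < P_value.
Proof.
  assert (H : (let '((p, q), _) := enclose (map (periodic P_word) (seq 0 24)) in
               P_floor * q <? 10000000000 * p)%Z = true)
    by (vm_compute; reflexivity).
  pose proof (cfrac_enclosed _ _ (starts_map_seq (periodic P_word) 24)) as E.
  fold P_value in E.
  destruct (enclose _) as [[p q] [r s]]. destruct E as (Hq & _ & E & _).
  apply Z.ltb_lt, IZR_lt in H. apply IZR_lt in Hq. rewrite !mult_IZR in H.
  eapply Rlt_le_trans; [|exact E]. unfold dec10.
  apply Rmult_lt_reg_r with (10000000000 * IZR q); [lra|].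
  replace (IZR p / IZR q * (10000000000 * IZR q))
    with (10000000000 * IZR p) by (field; lra).
  replace (IZR P_floor / 10000000000 * (10000000000 * IZR q))
    with (IZR P_floor * IZR q) by field.
  exact H.
Qed.

Definition tail_done (L R : list positive) : bool :=
  too_small R || prefixb P_word R.

(** [L] is the context on the left of the tail, read backwards from just
    before its last digit, which is [2].  The fuel is the
    length of P. *)
Definition forces_P (L : list positive) : Prop := search tail_done 12 L [] = true.

Lemma tail_step (A : Z -> positive) (i : Z) L :
  admissible_everywhere A -> forces_P L ->
  window A i L 2 [] -> P_value <= cfrac 0 (right_of A i) ->
  starts P_word (right_of A i).
Proof.
  intros HA HL Hw Hx.
  apply (search_sound A i (Z.of_nat (length L + 12)) _ tail_done (HA _ _)) with
    (fuel := 12%nat) (L := L) (R := []); auto; try (simpl; lia).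
  intros L' R H Hw'. apply orb_true_iff in H as [H|H].
  - exfalso. destruct Hw' as (_ & _ & HR).
    apply (too_small_sound _ _ HR) in H. pose proof P_floor_lt. lra.
  - destruct Hw' as (_ & _ & HR). eapply prefixb_starts; eauto.
Qed.

Definition P_context : list positive := tl (rev P_word).

Lemma P_context_forces : forces_P P_context.
Proof. vm_compute. reflexivity. Qed.

(** The contexts of the tail after [stem] in the first pattern and after
    [long_stem] in the second one.  Both run through the centre of the pattern
    into its other side, since [stem] alone does not force P. *)
Lemma c_context_forces : forces_P (tl (rev stem) ++ 2%positive :: Q_word ++ Q_word).
Proof. vm_compute. reflexivity. Qed.

Lemma B_context_forces :
  forces_P (tl (rev long_stem) ++ 2%positive :: B_right).
Proof. vm_compute. reflexivity. Qed.

(** An excess over the periodic value forces a block P, after which the rest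
    of the tail has an excess again, at least four times as large; as tails lie
    in the unit interval, the excess is arbitrarily small.  Evenness of the
    length of P keeps the direction of the inequality. *)
Lemma tail_excess_small (A : Z -> positive) :
  admissible_everywhere A ->
  forall n i L, forces_P L -> window A i L 2 [] ->
  cfrac 0 (right_of A i) - P_value <= (/ 4) ^ n.
Proof.
  intros HA. induction n as [|n IH]; intros i L HL Hw.
  - pose proof (cfrac_bounds (right_of A i)).
    pose proof (cfrac_bounds (periodic P_word)) as B. fold P_value in B.
    simpl pow. lra.
  - pose proof (pow_le (/ 4) (S n) ltac:(lra)) as Hpow.
    destruct (Rle_or_lt (cfrac 0 (right_of A i)) P_value) as [Hle|Hlt]; [lra|].
    pose proof (tail_step A i L HA HL Hw (Rlt_le _ _ Hlt)) as HP.
    assert (W : window A (i + 12) P_context 2 []).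
    { destruct Hw as (H1 & H2 & _).
      assert (W : window A i [] 2 P_word) by (split; [exact I|split; assumption]).
      apply (window_advance A i [] 2 (removelast P_word) 2 []) in W.
      replace (i + 12)%Z with (i + Z.of_nat (length (removelast P_word)) + 1)%Z
        by (simpl length; lia).
      eapply window_prefix; [|exact W]. reflexivity. }
    specialize (IH _ _ P_context_forces W).
    revert Hlt. rewrite (cfrac_starts _ _ HP), right_of_drop.
    change (Z.of_nat (length P_word)) with 12%Z.
    unfold P_value. rewrite cfrac_periodic by discriminate. fold P_value.
    intros Hlt.
    pose proof (cfrac_bounds (right_of A (i + 12))) as Bx.
    pose proof (cfrac_bounds (periodic P_word)) as BP. fold P_value in BP.
    destruct (Rle_or_lt (cfrac 0 (right_of A (i + 12))) P_value) as [Hle|Hlt'].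
    { pose proof (cf_word_monotone P_word _ _ Bx BP Hle) as M. simpl Nat.even in M.
      lra. }
    pose proof (cf_word_contract P_word _ _ Bx BP ltac:(simpl; lia)) as C.
    rewrite (Rabs_pos_eq (_ - P_value)) in C by lra.
    pose proof (Rle_abs (cf_word P_word (cfrac 0 (right_of A (i + 12)))
                         - cf_word P_word P_value)).
    simpl pow. lra.
Qed.

Lemma tail_max (A : Z -> positive) (i : Z) L :
  admissible_everywhere A -> forces_P L -> window A i L 2 [] ->
  cfrac 0 (right_of A i) <= P_value.
Proof.
  intros HA HL Hw.
  pose proof (le_of_quarter_pow _ (fun n => tail_excess_small A HA n i L HL Hw)). lra.
Qed.

(** * Closed forms and decimal bounds *)

Definition c_val : R :=
  (77 + sqrt 18229) / 82 + (17633692 - sqrt 151905) / 24923467.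

Lemma sqrt_unique_pos (x y : R) : 0 <= y -> y * y = x -> sqrt x = y.
Proof. intros Hy <-. apply sqrt_square, Hy. Qed.

(** The fixed-point equation of [cf_word Q_word] is
    [41 x^2 + 87 x - 65 = 0], of discriminant [18229]. *)
Lemma Q_closed_form : 2 + Q_value = (77 + sqrt 18229) / 82.
Proof.
  pose proof (cfrac_bounds (periodic Q_word)) as B. fold Q_value in B.
  pose proof (cfrac_periodic Q_word ltac:(discriminate)) as E. fold Q_value in E.
  assert (F : cf_word Q_word Q_value = (65 + 24 * Q_value) / (111 + 41 * Q_value)).
  { cbn [cf_word Q_word]. field. repeat split; lra. }
  rewrite F in E.
  assert (G : Q_value * (111 + 41 * Q_value) = 65 + 24 * Q_value).
  { rewrite E at 1. field. lra. }
  rewrite (sqrt_unique_pos 18229 (82 * Q_value + 87)); nra.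
Qed.

(** The fixed-point equation of [cf_word P_word] is, up to a factor [4],
    [237 x^2 + 444 x - 433 = 0], of discriminant [4 * 151905]. *)
Lemma P_closed_form : P_value = (sqrt 151905 - 222) / 237.
Proof.
  pose proof (cfrac_bounds (periodic P_word)) as B. fold P_value in B.
  pose proof (cfrac_periodic P_word ltac:(discriminate)) as E. fold P_value in E.
  assert (F : cf_word P_word P_value = (1732 + 671 * P_value) / (2447 + 948 * P_value)).
  { cbn [cf_word P_word]. field. repeat split; lra. }
  rewrite F in E.
  assert (G : P_value * (2447 + 948 * P_value) = 1732 + 671 * P_value).
  { rewrite E at 1. field. lra. }
  rewrite (sqrt_unique_pos 151905 (237 * P_value + 222)); nra.
Qed.

Lemma stem_closed_form : cf_word stem P_value = (17633692 - sqrt 151905) / 24923467.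
Proof.
  pose proof (cfrac_bounds (periodic P_word)) as B. fold P_value in B.
  assert (F : cf_word stem P_value = (670 + 283 * P_value) / (947 + 400 * P_value)).
  { cbn [cf_word stem]. field. repeat split; lra. }
  rewrite F. rewrite P_closed_form in *.
  pose proof (sqrt_sqrt 151905 ltac:(lra)) as S.
  set (r := sqrt 151905) in *.
  apply Rmult_eq_reg_r with (947 + 400 * ((r - 222) / 237)); [|lra].
  unfold Rdiv at 1. rewrite Rmult_assoc, Rinv_l by lra. lra.
Qed.

Lemma c_val_words : c_val = 2 + Q_value + cf_word stem P_value.
Proof. unfold c_val. rewrite stem_closed_form, Q_closed_form. reflexivity. Qed.

Lemma sqrt_between (x l u : R) :
  0 <= l -> 0 <= u -> l * l <= x -> x <= u * u -> l <= sqrt x <= u.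
Proof.
  intros Hl Hu H1 H2. split.
  - rewrite <- (sqrt_square l Hl). apply sqrt_le_1_alt, H1.
  - rewrite <- (sqrt_square u Hu). apply sqrt_le_1_alt, H2.
Qed.

Lemma c_val_bounds : 3.29304447990138 <= c_val < 3.29304447990139.
Proof.
  pose proof (sqrt_between 18229 135.01481400201979 135.01481400201980) as H1.
  pose proof (sqrt_between 151905 389.74991982 389.74991983) as H2.
  unfold c_val. lra.
Qed.

(** A digit at least [4] makes [lambda] at least [4].  A digit [3] whose two
    neighbours are at most [3] makes it at least [3 + 1/4 + 1/4]; the
    neighbours explain the range enlarged by one. *)
Lemma admissible_of_lambda (A : Z -> positive) (lo hi : Z) :
  (forall j, (lo - 1 <= j <= hi + 1)%Z -> lambda A j <= dec10 cap) ->
  admissible A lo hi.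
Proof.
  intros H.
  assert (Hcap : dec10 cap < 3.3) by (unfold dec10, cap; lra).
  assert (H3 : forall j, (lo - 1 <= j <= hi + 1)%Z -> (Zpos (A j) <= 3)%Z).
  { intros j Hj. specialize (H j Hj). rewrite lambda_split in H.
    pose proof (cfrac_bounds (right_of A j)). pose proof (cfrac_bounds (left_of A j)).
    assert (HA : IZR (Zpos (A j)) < 4) by lra. apply lt_IZR in HA. lia. }
  intros j Hj. split; [|apply H; lia].
  assert (Hn : (Zpos (A j) <> 3)%Z).
  { intros E.
    assert (K : forall a, (Zpos (a O) <= 3)%Z -> / 4 <= cfrac 0 a).
    { intros a Ha. rewrite cfrac_step. apply IZR_le in Ha.
      pose proof (cfrac_bounds (drop 1 a)). pose proof (IZR_pos_ge1 (a O)).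
      apply Rinv_le_contravar; lra. }
    pose proof (K (right_of A j) (H3 (j + 1 + Z.of_nat 0)%Z ltac:(lia))).
    pose proof (K (left_of A j) (H3 (j - 1 - Z.of_nat 0)%Z ltac:(lia))).
    specialize (H j ltac:(lia)). rewrite lambda_split, E in H. lra. }
  specialize (H3 j ltac:(lia)).
  destruct (A j) as [[?|?|]|[?|?|]|]; auto; lia.
Qed.

Lemma B_inf_bounds : dec10 32930444810 < B_inf < dec10 cap.
Proof.
  unfold B_inf. rewrite (cfrac_split 2).
  set (a := eventually_periodic [1%positive] _). set (b := eventually_periodic _ _).
  split.
  - apply (above_sum b a 32930444810 _ 2 _ (starts_map_seq b 30) (starts_map_seq a 30)).
    vm_compute. reflexivity.
  - apply (below_sum b a cap _ 2 _ (starts_map_seq b 30) (starts_map_seq a 30)).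
    vm_compute. reflexivity.
Qed.

(** Between [b_inf] and [c]. *)
Definition mid_bc : Z := 32930444000.

Lemma b_inf_lt : b_inf < dec10 mid_bc.
Proof.
  unfold b_inf. rewrite (cfrac_split 2).
  set (a := eventually_periodic _ [1; 1; 2; 2; 2; 1; 2]%positive).
  set (b := eventually_periodic _ _).
  apply (below_sum b a mid_bc _ 2 _ (starts_map_seq b 30) (starts_map_seq a 30)).
  vm_compute. reflexivity.
Qed.

(** * No Markov value between c and B_inf *)

(** [tail_max] transported through the known digits [w]; their parity decides
    whether the periodic tail maximises or minimises. *)
Lemma right_tail_compare (A : Z -> positive) (i : Z) L w :
  admissible_everywhere A ->
  window A i L 2 w -> w = removelast w ++ [2%positive] ->
  forces_P (rev (removelast w) ++ 2%positive :: L) ->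
  if Nat.even (length w) then cfrac 0 (right_of A i) <= cf_word w P_value
  else cf_word w P_value <= cfrac 0 (right_of A i).
Proof.
  intros HA Hw Ew Hf.
  assert (T : cfrac 0 (drop (length w) (right_of A i)) <= P_value).
  { assert (W : window A i L 2 (removelast w ++ [2%positive]))
      by (rewrite <- Ew; exact Hw).
    apply window_advance in W.
    rewrite right_of_drop, Ew, length_app.
    replace (i + Z.of_nat (length (removelast w) + length [2%positive]))%Z
      with (i + Z.of_nat (length (removelast w)) + 1)%Z by (simpl; lia).
    exact (tail_max A _ _ HA Hf W). }
  destruct Hw as (_ & _ & HR). rewrite (cfrac_starts _ _ HR).
  apply (cf_word_monotone w) in T; [|apply cfrac_bounds|apply cfrac_bounds].
  exact T.
Qed.

Lemma left_tail_compare (A : Z -> positive) (i : Z) R w :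
  admissible_everywhere A ->
  window A i w 2 R -> w = removelast w ++ [2%positive] ->
  forces_P (rev (removelast w) ++ 2%positive :: R) ->
  if Nat.even (length w) then cfrac 0 (left_of A i) <= cf_word w P_value
  else cf_word w P_value <= cfrac 0 (left_of A i).
Proof.
  intros HA Hw Ew Hf.
  replace i with (- - i)%Z in * by lia.
  rewrite <- mirror_right.
  apply right_tail_compare with R; auto.
  - apply admissible_everywhere_mirror, HA.
  - apply window_mirror. exact Hw.
Qed.

(** Both sides have an odd number of digits before the periodic part ([1 P]
    and [long_stem]), so the largest tails give the smallest value. *)
Lemma B_core_lambda (A : Z -> positive) (i : Z) :
  admissible_everywhere A -> B_core A i -> B_inf <= lambda A i.
Proof.
  intros HA HB.
  assert (HR : cf_word (1%positive :: P_word) P_value <= cfrac 0 (right_of A i)).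
  { apply (right_tail_compare A i long_stem (1%positive :: P_word) HA); auto.
    - eapply window_prefix; [|exact HB]. reflexivity.
    - vm_compute. reflexivity. }
  assert (HL : cf_word long_stem P_value <= cfrac 0 (left_of A i))
    by exact (left_tail_compare A i _ long_stem HA HB eq_refl B_context_forces).
  change (cf_word (1%positive :: P_word) P_value)
    with (cf_word [1%positive] (cf_word P_word P_value)) in HR.
  unfold P_value at 1 in HR. rewrite <- cfrac_periodic in HR by discriminate.
  fold P_value in HR.
  rewrite B_inf_words, lambda_split.
  destruct HB as (_ & -> & _). lra.
Qed.

(** The right side is exactly Q-periodic; [stem] has even length, so the
    largest left tail gives the largest value. *)
Lemma stage_lambda (A : Z -> positive) (i : Z) :
  admissible_everywhere A -> (forall j, ~ B_core A j) ->
  stage A i -> lambda A i <= c_val.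
Proof.
  intros HA HB Hs.
  assert (HQ : forall k, starts Q_word (right_of A (i + 7 * Z.of_nat k))).
  { intros k. eapply stage_forever with (hi := (i + 7 * Z.of_nat k + 46)%Z); eauto.
    lia. }
  assert (W : window A i stem 2 (Q_word ++ Q_word)).
  { destruct Hs as (HL & Hc & _). split; [exact HL|split; [exact Hc|]].
    apply starts_app. rewrite right_of_drop.
    split; [|exact (HQ 1%nat)].
    specialize (HQ O). replace (i + 7 * Z.of_nat 0)%Z with i in HQ by lia. exact HQ. }
  assert (HL : cfrac 0 (left_of A i) <= cf_word stem P_value)
    by exact (left_tail_compare A i _ stem HA W eq_refl c_context_forces).
  rewrite c_val_words, lambda_split, (cfrac_forced_periodic Q_word).
  2: simpl; lia.
  2: { intros k. rewrite right_of_drop.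
       replace (i + Z.of_nat (k * length Q_word))%Z with (i + 7 * Z.of_nat k)%Z
         by (simpl length; lia).
       apply HQ. }
  fold Q_value.
  destruct Hs as (_ & -> & _). lra.
Qed.

Lemma core_lambda (A : Z -> positive) (i : Z) :
  admissible_everywhere A -> (forall j, lambda A j < B_inf) ->
  core A i -> lambda A i <= c_val.
Proof.
  intros HA HB.
  assert (HnB : forall j, ~ B_core A j).
  { intros j Hj. pose proof (B_core_lambda A j HA Hj). specialize (HB j). lra. }
  intros [H|H].
  - apply stage_lambda; auto. eapply window_prefix; [|exact H]. reflexivity.
  - exfalso. exact (HnB i H).
Qed.

Lemma lambda_le_c (A : Z -> positive) (i : Z) :
  (forall j, lambda A j < B_inf) -> lambda A i <= c_val.
Proof.
  intros HB.
  assert (HA : admissible_everywhere A).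
  { intros lo hi. apply admissible_of_lambda. intros j _.
    pose proof B_inf_bounds. specialize (HB j). lra. }
  destruct (Rle_or_lt (lambda A i) (dec10 floor_c)) as [H|H].
  { pose proof c_val_bounds. unfold dec10, floor_c in H. lra. }
  destruct (core_of_large_lambda A i (HA _ _) (Rlt_le _ _ H)) as [C|C].
  - apply core_lambda; auto.
  - rewrite <- (Z.opp_involutive i), <- lambda_mirror.
    apply core_lambda; auto.
    + apply admissible_everywhere_mirror, HA.
    + intros j. rewrite lambda_mirror. apply HB.
Qed.

Lemma markov_below_c (x : R) : markov_spectrum x -> x < B_inf -> x <= c_val.
Proof.
  intros [A HA] Hx. unfold markov_value in HA.
  pose proof (Lub_Rbar_correct (fun x => exists i : Z, x = lambda A i)) as [Hub Hlub].
  rewrite HA in Hub, Hlub.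
  assert (H : forall i, lambda A i <= x) by (intros i; apply (Hub (lambda A i)); eauto).
  apply (Hlub (Finite c_val)). intros y [i ->].
  apply lambda_le_c. intros j. specialize (H j). lra.
Qed.

(** * A sequence with Markov value c *)

Definition c_left : nat -> positive := eventually_periodic stem P_word.

Definition c_seq (j : Z) : positive :=
  if (0 <? j)%Z then periodic Q_word (Z.to_nat (j - 1))
  else if (j =? 0)%Z then 2%positive
  else c_left (Z.to_nat (- j - 1)).

Lemma c_seq_right : right_of c_seq 0 = periodic Q_word.
Proof.
  apply functional_extensionality. intros k. unfold right_of, c_seq.
  destruct (Z.ltb_spec 0 (0 + 1 + Z.of_nat k)); [|lia]. f_equal. lia.
Qed.

Lemma c_seq_left : left_of c_seq 0 = c_left.
Proof.
  apply functional_extensionality. intros k. unfold left_of, c_seq.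
  destruct (Z.ltb_spec 0 (0 - 1 - Z.of_nat k)); [lia|].
  destruct (Z.eqb_spec (0 - 1 - Z.of_nat k) 0); [lia|]. f_equal. lia.
Qed.

Lemma lambda_c_seq_0 : lambda c_seq 0 = c_val.
Proof.
  rewrite lambda_split, c_seq_right, c_seq_left, c_val_words.
  unfold c_left. rewrite cfrac_eventually_periodic. reflexivity.
Qed.

Definition window_of (A : Z -> positive) (n : nat) (j : Z)
    : list positive * positive * list positive :=
  (map (left_of A j) (seq 0 n), A j, map (right_of A j) (seq 0 n)).

(** Periodicity of a sequence is only needed around [j] to move a window; this
    reduces all positions of [c_seq] to a finite range. *)
Lemma window_of_shift (A : Z -> positive) (n : nat) (j p : Z) :
  (forall k, (j - Z.of_nat n <= k <= j + Z.of_nat n)%Z -> A k = A (k + p)%Z) ->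
  window_of A n j = window_of A n (j + p).
Proof.
  intros H. unfold window_of. f_equal; [f_equal|].
  - apply map_ext_in. intros k Hk. apply in_seq in Hk. unfold left_of.
    rewrite H by lia. f_equal. lia.
  - apply H. lia.
  - apply map_ext_in. intros k Hk. apply in_seq in Hk. unfold right_of.
    rewrite H by lia. f_equal. lia.
Qed.

Lemma periodic_add (per : list positive) (k : nat) :
  per <> [] -> periodic per (length per + k) = periodic per k.
Proof. intros H. exact (equal_f (periodic_drop per H) k). Qed.

Lemma c_seq_period_right (j : Z) : (1 <= j)%Z -> c_seq j = c_seq (j + 7).
Proof.
  intros Hj. unfold c_seq.
  destruct (Z.ltb_spec 0 j); [|lia]. destruct (Z.ltb_spec 0 (j + 7)); [|lia].
  rewrite <- (periodic_add Q_word) by discriminate.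
  f_equal. simpl length. lia.
Qed.

Lemma c_seq_period_left (j : Z) : (j <= - 11)%Z -> c_seq j = c_seq (j - 12).
Proof.
  intros Hj. unfold c_seq.
  destruct (Z.ltb_spec 0 j); [lia|]. destruct (Z.ltb_spec 0 (j - 12)); [lia|].
  destruct (Z.eqb_spec j 0); [lia|]. destruct (Z.eqb_spec (j - 12) 0); [lia|].
  assert (E : forall k, c_left (length stem + k) = periodic P_word k).
  { intros k. rewrite <- (eventually_periodic_drop stem P_word). reflexivity. }
  replace (Z.to_nat (- j - 1)) with (length stem + Z.to_nat (- j - 11))%nat
    by (simpl length; lia).
  replace (Z.to_nat (- (j - 12) - 1))
    with (length stem + (length P_word + Z.to_nat (- j - 11)))%nat
    by (simpl length; lia).
  rewrite !E. symmetry. apply periodic_add. discriminate.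
Qed.

Definition small_window (w : list positive * positive * list positive) : bool :=
  let '(L, c, R) := w in below mid_bc L c R.

Lemma c_seq_windows_checked :
  forallb (fun k => let j := (Z.of_nat k - 40)%Z in
                    (j =? 0)%Z || small_window (window_of c_seq 12 j))
    (seq 0 81) = true.
Proof. vm_compute. reflexivity. Qed.

(** Beyond distance [40] a window of radius [12] and its translate by one
    period towards the origin stay inside the same periodic half. *)
Lemma c_seq_small_windows (j : Z) :
  j <> 0%Z -> small_window (window_of c_seq 12 j) = true.
Proof.
  assert (K : forall n j, (Z.abs j < Z.of_nat n)%Z -> j <> 0%Z ->
                          small_window (window_of c_seq 12 j) = true).
  { clear j. induction n as [|n IH]; intros j Hj Hj0; [lia|].
    destruct (Z_lt_le_dec 40 j) as [Hr|Hr]; [|destruct (Z_lt_le_dec j (- 40)) as [Hl|Hl]].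
    - rewrite (window_of_shift _ _ _ (- 7)).
      + apply IH; lia.
      + intros k Hk. rewrite (c_seq_period_right (k + - 7)) by lia. f_equal. lia.
    - rewrite (window_of_shift _ _ _ 12).
      + apply IH; lia.
      + intros k Hk. rewrite (c_seq_period_left (k + 12)) by lia. f_equal. lia.
    - pose proof (proj1 (forallb_forall _ _) c_seq_windows_checked
                    (Z.to_nat (j + 40)) ltac:(apply in_seq; lia)) as H.
      cbv zeta beta in H.
      replace (Z.of_nat (Z.to_nat (j + 40)) - 40)%Z with j in H by lia.
      apply orb_true_iff in H as [H|H]; [|exact H].
      apply Z.eqb_eq in H. lia. }
  apply (K (S (Z.to_nat (Z.abs j)))). lia.
Qed.

Lemma lambda_c_seq_le (j : Z) : lambda c_seq j <= c_val.
Proof.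
  destruct (Z.eq_dec j 0) as [->|Hj]; [rewrite lambda_c_seq_0; lra|].
  pose proof (c_seq_small_windows j Hj) as H.
  apply Rle_trans with (dec10 mid_bc).
  - apply Rlt_le. eapply below_sound; [|exact H].
    split; [apply starts_map_seq|split; [reflexivity|apply starts_map_seq]].
  - pose proof c_val_bounds. unfold dec10, mid_bc. lra.
Qed.

Lemma c_val_in_markov : markov_spectrum c_val.
Proof.
  exists c_seq. unfold markov_value. apply is_lub_Rbar_unique. split.
  - intros x [i ->]. apply lambda_c_seq_le.
  - intros b Hb. rewrite <- lambda_c_seq_0. apply Hb. exists 0%Z. reflexivity.
Qed.

(** * c is not a Lagrange value *)

Lemma stage_forces_period (A : Z -> positive) (i hi : Z) :
  admissible A (i - 46) hi ->
  (forall j, (i <= j)%Z -> (j + 46 <= hi)%Z -> ~ B_core A j) ->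
  stage A i ->
  forall j, (i < j)%Z -> (j + 60 <= hi)%Z -> A (j + 7)%Z = A j.
Proof.
  intros HA HB Hs j Hj Hhi.
  assert (Hn : exists k r, (r < 7)%nat
                 /\ j = (i + 7 * Z.of_nat k + 1 + Z.of_nat r)%Z).
  { exists (Z.to_nat ((j - i - 1) / 7)), (Z.to_nat ((j - i - 1) mod 7)).
    pose proof (Z.mod_pos_bound (j - i - 1) 7 ltac:(lia)).
    pose proof (Z.div_mod (j - i - 1) 7 ltac:(lia)).
    assert (0 <= (j - i - 1) / 7)%Z by (apply Z.div_pos; lia).
    lia. }
  destruct Hn as (k & r & Hr & ->).
  assert (Q : forall m, (i + 7 * Z.of_nat m + 46 <= hi)%Z ->
                A (i + 7 * Z.of_nat m + 1 + Z.of_nat r)%Z = nth r Q_word 1%positive).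
  { intros m Hm.
    destruct (stage_forever A i hi HA HB Hs m Hm) as [_ H].
    exact (starts_digit _ _ r H Hr). }
  rewrite (Q k) by lia. rewrite <- (Q (S k)) by lia. f_equal. lia.
Qed.

(** Right of the first occurrence the sequence has period [7].  At the second
    one, whichever way it is oriented, the fourth and the eleventh digit of
    [stem ++ [1]] are [2] and [1], seven positions apart. *)
Lemma c_cores_clash (A : Z -> positive) (i j hi : Z) :
  admissible A (i - 46) hi ->
  (forall j, (i <= j)%Z -> (j + 46 <= hi)%Z -> ~ B_core A j) ->
  (i + 20 <= j)%Z -> (j + 80 <= hi)%Z ->
  c_core A i -> c_core A j \/ c_core (mirror A) (- j) -> False.
Proof.
  intros HA HB Hij Hj Hi Hc.
  assert (Hs : stage A i) by (eapply window_prefix; [|exact Hi]; reflexivity).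
  pose proof (stage_forces_period A i hi HA HB Hs) as Hper.
  destruct Hc as [Hc|Hc].
  - destruct Hc as (HL & _).
    pose proof (starts_digit _ _ 3 HL ltac:(simpl; lia)) as H3.
    pose proof (starts_digit _ _ 10 HL ltac:(simpl; lia)) as H10.
    specialize (Hper (j - 11)%Z ltac:(lia) ltac:(lia)).
    unfold left_of in H3, H10.
    replace (j - 1 - Z.of_nat 3)%Z with (j - 11 + 7)%Z in H3 by lia.
    replace (j - 1 - Z.of_nat 10)%Z with (j - 11)%Z in H10 by lia.
    rewrite Hper, H10 in H3. discriminate.
  - apply (proj1 (window_mirror _ _ _ _ _)) in Hc. rewrite Z.opp_involutive in Hc.
    destruct Hc as (_ & _ & HR).
    pose proof (starts_digit _ _ 3 HR ltac:(simpl; lia)) as H3.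
    pose proof (starts_digit _ _ 10 HR ltac:(simpl; lia)) as H10.
    specialize (Hper (j + 4)%Z ltac:(lia) ltac:(lia)).
    unfold right_of in H3, H10.
    replace (j + 1 + Z.of_nat 3)%Z with (j + 4)%Z in H3 by lia.
    replace (j + 1 + Z.of_nat 10)%Z with (j + 4 + 7)%Z in H10 by lia.
    rewrite Hper, H3 in H10. discriminate.
Qed.

(** Just above [c]. *)
Definition ceil_c : Z := 32930444800.

Lemma B_core_above (A : Z -> positive) (i : Z) :
  B_core A i -> dec10 ceil_c < lambda A i.
Proof.
  intros H. eapply above_sound; [exact H|]. vm_compute. reflexivity.
Qed.

(** Occurrences of the pattern oriented to the right clash with every later
    occurrence, and reversed ones with every earlier occurrence that is far
    enough from the beginning; among three occurrences one of the two
    situations arises. *)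
Lemma limsup_near_c_impossible (A : Z -> positive) (N : Z) :
  (forall j, (N <= j)%Z -> lambda A j < dec10 ceil_c) ->
  (forall m, exists i, (m <= i)%Z /\ dec10 floor_c <= lambda A i) -> False.
Proof.
  intros Hev Hfr.
  assert (HA : forall lo hi, (N < lo)%Z -> admissible A lo hi).
  { intros lo hi Hlo. apply admissible_of_lambda. intros j Hj.
    specialize (Hev j ltac:(lia)). unfold dec10, ceil_c, cap in *. lra. }
  assert (HB : forall j, (N <= j)%Z -> ~ B_core A j).
  { intros j Hj H. apply B_core_above in H. specialize (Hev j Hj). lra. }
  assert (HBm : forall j, (N <= j)%Z -> ~ B_core (mirror A) (- j)).
  { intros j Hj H. apply B_core_above in H.
    rewrite lambda_mirror, Z.opp_involutive in H. specialize (Hev j Hj). lra. }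
  assert (Hc : forall m, exists i, (m <= i)%Z
                 /\ (c_core A i \/ c_core (mirror A) (- i))).
  { intros m. destruct (Hfr (Z.max m (N + 50))) as [i [Hi Hl]].
    exists i. split; [lia|].
    destruct (core_of_large_lambda A i) as [[H|H]|[H|H]]; auto.
    - apply HA. lia.
    - exfalso. apply (HB i); auto. lia.
    - exfalso. apply (HBm i); auto. lia. }
  destruct (Hc (N + 200)%Z) as (i1 & Hi1 & C1).
  destruct (Hc (i1 + 200)%Z) as (i2 & Hi2 & C2).
  destruct (Hc (i2 + 200)%Z) as (i3 & Hi3 & C3).
  assert (Fwd : forall i j, (N + 200 <= i)%Z -> (i + 200 <= j)%Z -> c_core A i ->
                  c_core A j \/ c_core (mirror A) (- j) -> False).
  { intros i j Hi Hij. apply (c_cores_clash A i j (j + 80)); try lia.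
    - apply HA. lia.
    - intros k Hk _. apply HB. lia. }
  (* If the first two are reversed, the clash happens in the mirror image,
     where the second one comes first. *)
  destruct C1 as [C1|C1]; [exact (Fwd i1 i2 Hi1 Hi2 C1 C2)|].
  destruct C2 as [C2|C2]; [exact (Fwd i2 i3 ltac:(lia) Hi3 C2 C3)|].
  apply (c_cores_clash (mirror A) (- i2) (- i1) (- (N + 1))); auto; try lia.
  - replace (- i2 - 46)%Z with (- (i2 + 46))%Z by lia.
    apply admissible_mirror, HA. lia.
  - intros j _ Hj. rewrite <- (Z.opp_involutive j). apply HBm. lia.
Qed.

Lemma c_val_notin_lagrange : ~ lagrange_spectrum c_val.
Proof.
  intros [A HA]. unfold lagrange_value, LimSup_seq in HA.
  destruct (ex_LimSup_seq (fun n => lambda A (Z.of_nat n))) as [l Hl].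
  simpl in HA. subst l.
  pose proof c_val_bounds as Hc.
  destruct (Hl (mkposreal (/ 100000000000) ltac:(lra))) as [Hfr [N HN]].
  simpl in Hfr, HN.
  apply (limsup_near_c_impossible A (Z.of_nat N)).
  - intros j Hj. specialize (HN (Z.to_nat j) ltac:(lia)).
    rewrite Z2Nat.id in HN by lia. unfold dec10, ceil_c. lra.
  - intros m. destruct (Hfr (Z.to_nat m)) as [n [Hn Hl']].
    exists (Z.of_nat n). split; [lia|]. unfold dec10, floor_c. lra.
Qed.

Theorem proposition1p3 :
  let c := (77 + sqrt 18229) / 82 + (17633692 - sqrt 151905) / 24923467 in
  is_largest
    (fun x => (markov_spectrum x /\ ~ lagrange_spectrum x) /\ b_inf < x < B_inf)
    c
  /\ 3.29304447990138 <= c < 3.29304447990139.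
Proof.
  intros c. change c with c_val. pose proof c_val_bounds as Hc.
  split; [|exact Hc]. split.
  - split; [split; [exact c_val_in_markov|exact c_val_notin_lagrange]|].
    pose proof b_inf_lt. pose proof B_inf_bounds. unfold dec10, mid_bc in *. lra.
  - intros x [[HM _] [_ HB]]. exact (markov_below_c x HM HB).
Qed.
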